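(* Let $(F_n)_{n\ge 0}$ be the Fibonacci sequence, $F_0=0$, $F_1=1$, $F_n=F_{n-1}+F_{n-2}$ for $n\ge 2$. Call a (finite or infinite) sequence $a_1,a_2,\dots$ of positive Fibonacci numbers a walk by appending one digit if for every pair of consecutive terms there is a decimal digit $d_i\in\{0,1,\dots,9\}$ with $a_{i+1}=10a_i+d_i$. Then there is no infinite such walk. More precisely, every such walk has length (number of terms, including the starting term $a_1$) at most $2$.
   Context: A walk is obtained by starting from a Fibonacci number and repeatedly appending exactly one decimal digit to the right, requiring every term to be a Fibonacci number. *)

(* Defs.v *)
From mathcomp Require Import all_boot.

Set Implicit Arguments.
Unset Strict Implicit.
Unset Printing Implicit Defensive.

Fixpoint fib (n : nat) : nat :=
  match n with
  | 0 => 0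
  | 1 => 1
  | (m.+1 as p).+1 => fib p + fib m
  end.

Definition pos_fib (a : nat) : Prop := 0 < a /\ exists n, a = fib n.

Definition append_digit : rel nat :=
  fun a b => [exists d : 'I_10, b == 10 * a + d].

Definition finite_walk (s : seq nat) : Prop :=
  (forall a, a \in s -> pos_fib a) /\ sorted append_digit s.

Definition infinite_walk (u : nat -> nat) : Prop :=
  (forall i, pos_fib (u i)) /\ (forall i, append_digit (u i) (u i.+1)).

(* Main.v *)
(** If [a = F_n] with [n >= 7], then [F_(n+4) < 10 a] and [10 a + 9 < F_(n+5)],
    so no digit can be appended to [a]. The second term of a walk is at least
    [10], hence at least [F_7 = 13], so there is no third term. *)

Require Import Defs.
From mathcomp Require Import all_boot.
From mathcomp Require Import zify.

Lemma fibSS n : fib n.+2 = fib n.+1 + fib n.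
Proof. by []. Qed.

Lemma leq_fib : {homo fib : m n / m <= n}.
Proof.
apply: homo_leq => // [? ? ?|[|n]] //; first exact: leq_trans.
by rewrite fibSS leq_addr.
Qed.

(** Serves to reduce [fib (n + 4)] and [fib (n + 5)] to [3 F_(n+1) + 2 F_n] and
    [5 F_(n+1) + 3 F_n]. *)
Lemma fib_addS m n : fib (m + n.+1) = fib m.+1 * fib n.+1 + fib m * fib n.
Proof.
elim: m n => [|m IHm] n; first by rewrite mul1n mul0n addn0.
by rewrite addSnnS IHm !fibSS mulnDr mulnDl addnAC.
Qed.

Lemma fib_decuple_bounds n : 7 <= n ->
  fib (n + 4) < 10 * fib n /\ 10 * fib n + 9 < fib (n + 5).
Proof.
move=> n_ge7; rewrite !fib_addS.
(* With [n = m + 3], [x = F_m] and [y = F_(m+1)], the claims read [13y + 8x < 20y + 10x] and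
   [20y + 10x + 9 < 21y + 13x]. The second means [9 < y + 3x], which follows from [x >= 3] and
   [y >= 5]. The bound 7 is sharp: [F_11 = 89 = 10 * F_6 + 9]. *)
case: n n_ge7 => [|[|[|m]]] // m_ge4.
have : fib 4 <= fib m by apply: leq_fib.
have : fib 5 <= fib m.+1 by apply: leq_fib.
rewrite (fibSS m.+2) (fibSS m.+1) (fibSS m).
move: (fib m) (fib m.+1) => x y /=; lia.
Qed.

Lemma append_digitP a b :
  reflect (exists2 d, d < 10 & b = 10 * a + d) (append_digit a b).
Proof.
apply: (iffP existsP) => [[d /eqP ->]|[d lt_d10 ->]]; first by exists d.
by exists (Ordinal lt_d10).
Qed.

Lemma fib_no_append_digit n b :
  7 <= n -> append_digit (fib n) b -> ~ exists k, b = fib k.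
Proof.
move=> /fib_decuple_bounds[lo hi] /append_digitP[d lt_d10 ->] [k Fk].
have [le_k|lt_k] := leqP k (n + 4); first by have := leq_fib _ _ le_k; lia.
have : fib (n + 5) <= fib k by apply: leq_fib; lia.
lia.
Qed.

Lemma no_three_term_walk a b c : pos_fib a -> pos_fib b -> pos_fib c ->
  append_digit a b -> append_digit b c -> False.
Proof.
move=> [a_gt0 _] [_ [n ->]] [_ Fc] /append_digitP[d _ Fn] bc.
apply: (fib_no_append_digit n c) bc Fc.
have [//|lt_n7] := leqP 7 n.
(* Here 8 is [F_6], whereas [F_n = 10 a + d >= 10] because [a] is positive. *)
have : fib n <= 8 by apply: (leq_fib n 6).
lia.
Qed.

Theorem theorem1p2 :
  ~ (exists u : nat -> nat, infinite_walk u) /\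
  (forall s : seq nat, finite_walk s -> size s <= 2).
Proof.
split=> [[u [Fu step_u]]|[|a [|b [|c s]]] // [Fs /and3P[ab bc _]]].
  exact: no_three_term_walk (Fu 0) (Fu 1) (Fu 2) (step_u 0) (step_u 1).
by case: (@no_three_term_walk a b c) => //; apply: Fs; rewrite !inE eqxx ?orbT.
Qed.
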